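(* Let $G$ be a countably infinite amenable cancellative semigroup. Then there exists an amenable group $\widetilde G$ containing $G$ as a subsemigroup, such that any F{\o}lner sequence $(F_n)$ in $G$ is a F{\o}lner sequence in $\widetilde G$.
   Context: A semigroup $G$ is (two-sided) cancellative if $ab=ac\Rightarrow b=c$ and $ba=ca\Rightarrow b=c$. For an element $g$ and a subset $F$ of a semigroup $H$, $g^{-1}F=\{h\in H: gh\in F\}$. A sequence $(F_n)$ of (nonempty) finite subsets of a cancellative semigroup $H$ is a (left) F{\o}lner sequence in $H$ if $\lim_n |F_n\cap g^{-1}F_n|/|F_n|=1$ for every $g\in H$. Amenable means (left) amenable (for countable cancellative semigroups: a left F{\o}lner sequence exists). *)

(* Defs.v *)
From mathcomp Require Import all_boot all_order all_algebra finmap.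
From mathcomp Require Import all_classical all_reals all_analysis.

Set Implicit Arguments.
Unset Strict Implicit.
Unset Printing Implicit Defensive.

Import numFieldNormedType.Exports.

Local Open Scope classical_set_scope.
Local Open Scope ring_scope.

Definition cancellative (G : semigroupType) : Prop :=
  right_injective (fun a b : G => (a * b)%g) /\
  left_injective (fun a b : G => (a * b)%g).

Definition lpreim (H : semigroupType) (g : H) (F : {fset H}) : {pred H} :=
  [pred h | (g * h)%g \in F].

Definition folner (R : realType) (H : semigroupType) (F : nat -> {fset H}) :
    Prop :=
  (forall n, F n != fset0) /\
  (forall g : H,
     (fun n => #|` [fset h in F n | h \in lpreim g (F n)]|%fset%:R
               / #|` F n|%fset%:R : R) @ \oo --> (1 : R)).

(* This is amenability for countable cancellative semigroups.  A group with a
   Folner sequence is automatically countable: for every g, the set g F_n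
   eventually meets F_n, so g lies in the union of the F_n F_n^-1. *)
Definition amenable (R : realType) (H : semigroupType) : Prop :=
  exists F : nat -> {fset H}, folner R F.

(* Main.v *)
Require Import Defs.
From HB Require Import structures.
From mathcomp Require Import all_boot all_order all_algebra finmap.
From mathcomp Require Import all_classical all_reals all_analysis.

(** The theorem has two independent halves.

    The algebraic half is Ore's construction.  Call an element [x] of a finite
    set [A] a stayer for [g] when [g * x] is again in [A].  If almost
    all elements of [A] are stayers for [g] and almost all are stayers for [h],
    then the images of the stayers under [g] and under [h] are two subsets of
    [A] that each fill almost all of it, so they meet: [g * u = h * v] for some
    [u] and [v] ([folner_common_multiple]).  A cancellative semigroup in which
    any two elements have such a common right multiple embeds in a group all of
    whose elements are quotients [a * b^-1] of its own elements
    ([to_fraction_inj], [fraction_quotient]).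

    The analytic half is that, along a fixed sequence [F] of finite nonempty
    subsets of a group, the elements [g] that keep asymptotically all of [F n]
    inside [F n] form a subgroup.  They are closed under products because a
    point is lost by [g * h] only if it is lost by [h] or sent by [h] to a point
    lost by [g] ([almost_invariantM]), and under inverses because [g] maps its
    stayers bijectively onto those of [g^-1] ([card_stayV]).  For the image of a
    Folner sequence of the semigroup this subgroup contains the semigroup, hence
    all quotients [a * b^-1], hence the whole group. *)

Set Implicit Arguments.
Unset Strict Implicit.
Unset Printing Implicit Defensive.

Import Order.TTheory GRing.Theory Num.Theory numFieldNormedType.Exports.

Local Open Scope classical_set_scope.
Local Open Scope ring_scope.

(** * The group of right fractions *)

(** The hypotheses of Ore's construction are bundled with the semigroup so that
    the group structure on its fractions can be inferred from their type. *)
Record oreSemigroup := OreSemigroup {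
  ore_sort :> semigroupType;
  ore_cancellative : cancellative ore_sort;
  ore_point : ore_sort;
  common_multiple : forall a b : ore_sort, exists u v, (a * u = b * v)%g
}.

Section Fractions.
Variable G : oreSemigroup.
Local Open Scope group_scope.
Implicit Types (x y z u v w : G) (r s t : G -> G -> Prop).

Lemma ore_mulgI x y z : x * y = x * z -> y = z.
Proof. by case: (ore_cancellative G) => inj _; apply: inj. Qed.

Lemma ore_mulIg x y z : y * x = z * x -> y = z.
Proof. by case: (ore_cancellative G) => _ inj; apply: inj. Qed.

(** A fraction [h = a * b^-1] is encoded by the graph of the partial left
    translation [x |-> h * x] of [G], that is, by its full equivalence class of
    pairs (numerator, denominator).  Graphs are thus canonical representatives,
    and no quotient is taken; conversely, a relation [r] as below is the graph
    of [y * x^-1] for any pair [r y x]. *)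
Definition is_fraction r : Prop :=
  [/\ exists y x, r y x,
      forall u y x, r (y * u) (x * u) <-> r y x,
      forall x y y', r y x -> r y' x -> y = y'
    & forall y x x', r y x -> r y x' -> x = x'].

(** For the graphs [r] of [h] and [s] of [k], the plain composite relation can
    be too small, since [k * x] may lie outside [G] while [h * k * x] is in [G];
    the factor [u] moves the intermediate point [w = k * x * u] into [G]. *)
Definition frac_mul r s y x : Prop := exists u w, r (y * u) w /\ s w (x * u).

Definition frac_inv r y x : Prop := r x y.

Definition frac_of (g : G) y x : Prop := y = g * x.

Lemma is_fraction_eq : is_fraction eq.
Proof.
split=> [|u y x|x y y' -> ->|y x x' -> ->] //.
  by exists (ore_point G), (ore_point G).
by split=> [/ore_mulIg|->].
Qed.

Lemma is_fraction_of g : is_fraction (frac_of g).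
Proof.
rewrite /frac_of; split=> [|u y x|x y y' -> ->|y x x' -> /ore_mulgI] //.
  by exists (g * ore_point G), (ore_point G).
by rewrite mulgA; split=> [/ore_mulIg|->].
Qed.

Lemma is_fraction_inv r : is_fraction r -> is_fraction (frac_inv r).
Proof.
case=> [[y [x rxy]] sat fun_r inj_r]; split=> [|u y' x'|x' y' z'|y' x' z'].
- by exists x, y.
- exact: sat.
- exact: inj_r.
- exact: fun_r.
Qed.

Lemma frac_mul_inv r s :
  frac_inv (frac_mul r s) = frac_mul (frac_inv s) (frac_inv r).
Proof.
apply/funext => y; apply/funext => x; apply/propext.
by split=> -[u [w [? ?]]]; exists u, w.
Qed.

(** A common right multiple of the two saturating factors makes the two
    intermediate points comparable, and then cancellation applies. *)
Lemma frac_mul_fun r s x y y' : is_fraction r -> is_fraction s ->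
  frac_mul r s y x -> frac_mul r s y' x -> y = y'.
Proof.
case=> _ sat_r fun_r _ [_ sat_s fun_s _] [u [w [rw sw]]] [u' [w' [rw' sw']]].
have [a [b eq_ab]] := common_multiple u u'.
have eq_w : w * a = w' * b.
  apply: (fun_s (x * u * a)); first exact/sat_s.
  by rewrite -mulgA eq_ab mulgA; apply/sat_s.
apply: (@ore_mulIg (u * a)); apply: (fun_r (w * a)).
  by rewrite mulgA; apply/sat_r.
by rewrite eq_ab eq_w mulgA; apply/sat_r.
Qed.

Lemma is_fraction_mul r s :
  is_fraction r -> is_fraction s -> is_fraction (frac_mul r s).
Proof.
move=> fr fs; have [[y [w rw]] sat_r _ _] := fr.
have [[w' [x sw']] sat_s _ _] := fs.
split.
- have [a [b eq_ab]] := common_multiple w w'.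
  (* y w^-1 = (y a) (w a)^-1 and w' x^-1 = (w' b) (x b)^-1, where w a = w' b. *)
  exists (y * a), (x * b), (ore_point G), (w * a * ore_point G).
  split; first by do 2!apply/sat_r.
  by rewrite eq_ab; do 2!apply/sat_s.
- move=> u y' x'; split=> -[a [z [rz sz]]].
    by exists (u * a), z; rewrite !mulgA.
  have [b [c eq_bc]] := common_multiple u a.
  exists b, (z * c); rewrite -!mulgA eq_bc !mulgA.
  by split; [apply/sat_r|apply/sat_s].
- by move=> x' y' z'; apply: frac_mul_fun.
(* Injectivity is functionality of the inverse relation. *)
- move=> y' x' z' yx' yz'.
  apply: (@frac_mul_fun (frac_inv s) (frac_inv r) y').
  + exact: is_fraction_inv.
  + exact: is_fraction_inv.
  + by rewrite -frac_mul_inv.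
  + by rewrite -frac_mul_inv.
Qed.

Lemma frac_mul1 r : is_fraction r -> frac_mul eq r = r.
Proof.
case=> _ sat_r _ _; apply/funext => y; apply/funext => x; apply/propext.
split=> [[u [w [<- /sat_r]]] //|ryx].
by exists (ore_point G), (y * ore_point G); split=> //; apply/sat_r.
Qed.

Lemma frac_mulV r : is_fraction r -> frac_mul r (frac_inv r) = eq.
Proof.
case=> [[p [q rpq]] sat_r fun_r _]; apply/funext => y; apply/funext => x.
apply/propext; split=> [[u [w [ryw rxw]]]|<-].
  exact: ore_mulIg (fun_r _ _ _ ryw rxw).
have [u [v eq_uv]] := common_multiple y p.
by exists u, (q * v); rewrite /frac_inv eq_uv; split; apply/sat_r.
Qed.

(** Both sides relate [y] to [x] exactly when, for some [u], there is a chain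
    [y * u], [w], [z], [x * u] linked by [r], [s] and [t]: saturation lets the
    two separate correcting factors be merged into one. *)
Lemma frac_mulA r s t : is_fraction r -> is_fraction s -> is_fraction t ->
  frac_mul r (frac_mul s t) = frac_mul (frac_mul r s) t.
Proof.
case=> _ sat_r _ _ [_ sat_s _ _] [_ sat_t _ _].
apply/funext => y; apply/funext => x; apply/propext; split.
  move=> [u [w [rw [v [z [sz tz]]]]]].
  exists (u * v), z; split; last by rewrite mulgA.
  exists (ore_point G), (w * v * ore_point G).
  by split; [rewrite !mulgA; do 2!apply/sat_r|apply/sat_s].
move=> [u [w [[v [z [rz sz]]] tw]]].
exists (u * v), z; split; first by rewrite mulgA.
exists (ore_point G), (w * v * ore_point G).
by split; [apply/sat_s|rewrite !mulgA; do 2!apply/sat_t].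
Qed.

Lemma frac_ofM g h : frac_of (g * h) = frac_mul (frac_of g) (frac_of h).
Proof.
apply/funext => y; apply/funext => x; apply/propext; rewrite /frac_of.
split=> [->|[u [w [yuE wE]]]]; last first.
  by apply: (@ore_mulIg u); rewrite yuE wE !mulgA.
by exists (ore_point G), (h * (x * ore_point G)); rewrite !mulgA.
Qed.

(** This is what makes the group consist of quotients: any pair in a graph is a
    numerator and a denominator of it. *)
Lemma frac_of_quotient r a b :
  is_fraction r -> r a b -> frac_of a = frac_mul r (frac_of b).
Proof.
case=> _ sat_r fun_r _ rab; apply/funext => y; apply/funext => x.
apply/propext; split=> [->|[u [w [ryw wE]]]].
  exists (ore_point G), (b * (x * ore_point G)); split=> //.
  by rewrite -mulgA; apply/sat_r.
apply: (@ore_mulIg u); apply: fun_r ryw _.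
by rewrite wE -mulgA; apply/sat_r.
Qed.

End Fractions.

Record fraction (G : oreSemigroup) := Fraction {
  graph : G -> G -> Prop;
  graphP : is_fraction graph
}.

Lemma graph_inj (G : oreSemigroup) : injective (@graph G).
Proof.
move=> [r fr] [s fs] /= eq_rs; move: fs; rewrite -eq_rs => fs.
by congr Fraction; apply: Prop_irrelevance.
Qed.

HB.instance Definition _ (G : oreSemigroup) := gen_eqMixin (fraction G).
HB.instance Definition _ (G : oreSemigroup) := gen_choiceMixin (fraction G).

Section FractionGroup.
Variable G : oreSemigroup.
Implicit Types p q : fraction G.

Definition fraction_one := Fraction (is_fraction_eq G).
Definition fraction_inv p := Fraction (is_fraction_inv (graphP p)).
Definition fraction_mul p q := Fraction (is_fraction_mul (graphP p) (graphP q)).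

Lemma fraction_mulA : associative fraction_mul.
Proof.
by move=> p q z; apply: graph_inj; apply: frac_mulA; apply: graphP.
Qed.

Lemma fraction_mul1 : left_id fraction_one fraction_mul.
Proof. by move=> p; apply: graph_inj; apply: frac_mul1 (graphP p). Qed.

Lemma fraction_mulV : right_inverse fraction_one fraction_inv fraction_mul.
Proof. by move=> p; apply: graph_inj; apply: frac_mulV (graphP p). Qed.

Lemma fraction_invK : involutive fraction_inv.
Proof. by move=> p; apply: graph_inj. Qed.

Lemma fraction_invM :
  {morph fraction_inv : p q / fraction_mul p q >-> fraction_mul q p}.
Proof. by move=> p q; apply: graph_inj; apply: frac_mul_inv. Qed.

Lemma fraction_mulVl : left_inverse fraction_one fraction_inv fraction_mul.
Proof. by move=> p; rewrite -{2}[p]fraction_invK fraction_mulV. Qed.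

HB.instance Definition _ := isStarMonoid.Build (fraction G)
  fraction_mulA fraction_mul1 fraction_invK fraction_invM.
HB.instance Definition _ :=
  StarMonoid_isGroup.Build (fraction G) fraction_mulVl.

Definition to_fraction (g : G) : fraction G := Fraction (is_fraction_of g).

Lemma to_fractionM : {morph to_fraction : g h / (g * h)%g}.
Proof. by move=> g h; apply: graph_inj; apply: frac_ofM. Qed.

HB.instance Definition _ :=
  isMultiplicative.Build G (fraction G) to_fraction to_fractionM.

Lemma to_fraction_inj : injective to_fraction.
Proof.
move=> g h [/(congr1 (fun r => r (g * ore_point G)%g (ore_point G)))].
rewrite /frac_of => eq_gh; apply: (@ore_mulIg _ (ore_point G)).
by rewrite -eq_gh.
Qed.

Lemma fraction_quotient p :
  exists a b, p = (to_fraction a * (to_fraction b)^-1)%g.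
Proof.
have [[a [b pab]] _ _ _] := graphP p; exists a, b.
suff -> : to_fraction a = (p * to_fraction b)%g by rewrite mulgK.
by apply: graph_inj; apply: frac_of_quotient (graphP p) pab.
Qed.

End FractionGroup.

(** * Counting the points that a translation keeps in a finite set *)

Section Stay.
Variable H : semigroupType.
Implicit Types (g h : H) (A : {fset H}).

Definition stay g A := [fset h in A | h \in lpreim g A]%fset.

Lemma mem_stay g A x : (x \in stay g A) = (x \in A) && (g * x \in A)%g.
Proof. by rewrite !inE. Qed.

Lemma stay_image_sub g A : ([fset (g * x)%g | x in stay g A] `<=` A)%fset.
Proof.
by apply/fsubsetP => _ /imfsetP[x /= + ->]; rewrite mem_stay => /andP[].
Qed.

Lemma card_stay_image g A : injective (fun x => g * x)%g ->
  #|` [fset (g * x)%g | x in stay g A]%fset| = #|` stay g A|.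
Proof. exact: card_imfset. Qed.

(** Inside [A], the image under [h] of the points staying for [h] meets the set
    of points staying for [g] in images of points staying for [g * h]; now apply
    inclusion and exclusion. *)
Lemma card_stayM g h A : injective (fun x => h * x)%g ->
  (#|` stay g A| + #|` stay h A| <= #|` A| + #|` stay (g * h)%g A|)%N.
Proof.
move=> inj_h; rewrite -(card_stay_image A inj_h) -cardfsUI leq_add //.
  apply/fsubset_leq_card; rewrite fsubUset stay_image_sub andbT.
  by apply/fsubsetP => x; rewrite mem_stay => /andP[].
have -> : #|` stay (g * h)%g A| =
    #|` [fset (h * x)%g | x in stay (g * h)%g A]%fset|.
  by apply/esym/card_imfset.
apply/fsubset_leq_card/fsubsetP => y /fsetIP[+ /imfsetP[x /= + yE]].
rewrite yE !mem_stay => /andP[_ ghxA] /andP[xA _].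
by apply: in_imfset; rewrite /= mem_stay xA -mulgA.
Qed.

(** The translates [g * u] and [h * v] of the stayers are two subsets of [A] too
    large to be disjoint. *)
Lemma common_multiple_stay g h A :
  injective (fun x => g * x)%g -> injective (fun x => h * x)%g ->
  (#|` A| < #|` stay g A| + #|` stay h A|)%N ->
  exists u v, (g * u = h * v)%g.
Proof.
move=> inj_g inj_h.
rewrite -(card_stay_image A inj_g) -(card_stay_image A inj_h) -cardfsUI => lt_A.
set B := [fset _ | _ in _]%fset in lt_A.
set C := [fset _ | _ in _]%fset in lt_A.
have : (0 < #|` (B `&` C)%fset|)%N.
  rewrite -(ltn_add2l #|` (B `|` C)%fset|) addn0; apply: leq_ltn_trans lt_A.
  by apply/fsubset_leq_card; rewrite fsubUset !stay_image_sub.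
rewrite cardfs_gt0 => /fset0Pn[x /fsetIP[/imfsetP[u _ ->] /imfsetP[v _ eq_uv]]].
by exists u, v.
Qed.

End Stay.

(** Left translation by [h] maps the points staying for [h] bijectively onto the
    points staying for [h^-1]. *)
Lemma card_stayV (H : groupType) (h : H) (A : {fset H}) :
  #|` stay h^-1%g A| = #|` stay h A|.
Proof.
rewrite -(card_stay_image A (mulgI h)); congr #|` _|.
apply/fsetP => x; rewrite mem_stay.
apply/andP/imfsetP => [[xA hxA]|[y /= yA ->]].
  by exists (h^-1 * x)%g; rewrite ?mulVKg //= mem_stay hxA mulVKg.
by move: yA; rewrite mem_stay mulKg => /andP[].
Qed.

Lemma stay_imfset (G H : semigroupType) (f : {multiplicative G -> H}) g
    (A : {fset G}) : injective f ->
  stay (f g) [fset f x | x in A]%fset = [fset f x | x in stay g A]%fset.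
Proof.
move=> inj_f; apply/fsetP => y; rewrite mem_stay; apply/andP/imfsetP.
  move=> [/imfsetP[x /= xA ->]]; rewrite -gmulfM mem_imfset //= => gxA.
  by exists x; rewrite //= mem_stay xA.
move=> [x /=]; rewrite mem_stay => /andP[xA gxA ->].
by rewrite -gmulfM !mem_imfset.
Qed.

(** * Asymptotically invariant sequences *)

Section AlmostInvariance.
Variable R : realType.

Definition almost_invariant (H : semigroupType) (F : nat -> {fset H}) (g : H) :=
  (fun n => #|` stay g (F n)|%:R / #|` F n|%:R : R) @ \oo --> (1 : R).

(** If proportions [1 - d] and [1 - e] of the points stay for [g] and for [h],
    then a proportion of at least [1 - d - e] stays for [g * h]. *)
Lemma almost_invariantM (H : semigroupType) (F : nat -> {fset H}) g h :
  (forall n, F n != fset0) -> injective (fun x => h * x)%g ->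
  almost_invariant F g -> almost_invariant F h -> almost_invariant F (g * h)%g.
Proof.
move=> F0 inj_h gF hF.
pose r k n : R := #|` stay k (F n)|%:R / #|` F n|%:R.
have ghF : (fun n => r g n + r h n - 1) @ \oo --> (1 : R).
  rewrite -[X in _ --> X](addrK (1 : R)).
  apply: cvgB; [apply: cvgD; [exact: gF|exact: hF]|exact: cvg_cst].
apply: squeeze_cvgr ghF (@cvg_cst _ (1 : R) _ _ _); apply: nearW => n.
rewrite /r.
have card_gt0 : (0 : R) < #|` F n|%:R by rewrite ltr0n cardfs_gt0.
rewrite ler_pdivrMr // mul1r ler_nat; apply/andP; split; last first.
  by apply/fsubset_leq_card/fsubsetP => x; rewrite mem_stay => /andP[].
rewrite lerBlDr -[X in _ <= _ + X](divff (lt0r_neq0 card_gt0)) -!mulrDl.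
by rewrite ler_pM2r ?invr_gt0 // -!natrD ler_nat [leqRHS]addnC card_stayM.
Qed.

(** The proportions of points staying for [g] and for [h] both tend to one, so
    at some index their sum exceeds one. *)
Lemma folner_common_multiple (H : semigroupType) (F : nat -> {fset H}) :
  folner R F -> right_injective (fun a b : H => (a * b)%g) ->
  forall g h : H, exists u v, (g * u = h * v)%g.
Proof.
move=> [F0 invF] inj g h.
pose r k n : R := #|` stay k (F n)|%:R / #|` F n|%:R.
have ghF : (fun n => r g n + r h n) @ \oo --> (1 + 1 : R).
  by apply: cvgD; [exact: invF|exact: invF].
have : \forall n \near \oo, (1 : R) < r g n + r h n.
  by apply: (cvgr_gt _ ghF); rewrite ltrDl.
case=> n _ /(_ n (leqnn n)) /=.
rewrite -mulrDl ltr_pdivlMr ?ltr0n ?cardfs_gt0 // mul1r -natrD ltr_nat.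
exact: common_multiple_stay.
Qed.

End AlmostInvariance.

Theorem theorem2p12 (R : realType) (G : semigroupType)
    (Gcard : ([set: G]%classic #= [set: nat]%classic)%card)
    (Gcanc : cancellative G)
    (Gamen : amenable R G) :
  exists (H : groupType) (f : {multiplicative G -> H}),
    [/\ amenable R H,
        injective f
      & forall F : nat -> {fset G},
          folner R F -> folner R (fun n => [fset f x | x in F n]%fset)].
Proof.
have [F0 F0_folner] := Gamen.
have [x0 _] : exists x0, x0 \in F0 0%N by apply/fset0Pn; case: F0_folner.
have ore := folner_common_multiple F0_folner Gcanc.1.
pose S := OreSemigroup Gcanc x0 ore.
pose f : {multiplicative S -> fraction S} := @to_fraction S.
have inj_f : injective f := @to_fraction_inj S.
suff fF : forall F : nat -> {fset G},
    folner R F -> folner R (fun n => [fset f x | x in F n]%fset).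
  exists (fraction S), f; split=> //.
  exists (fun n => [fset f x | x in F0 n]%fset); exact: fF.
move=> F [F_neq0 F_inv].
pose fF n := [fset f x | x in F n]%fset.
have fF_neq0 n : fF n != fset0.
  by rewrite -cardfs_gt0 card_imfset // cardfs_gt0.
have inv_f g : almost_invariant R fF (f g).
  have ratioE n : #|` stay (f g) (fF n)|%:R / #|` fF n|%:R =
      #|` stay g (F n)|%:R / #|` F n|%:R :> R.
    by rewrite /fF stay_imfset // !card_imfset.
  rewrite /almost_invariant (funext ratioE); exact: F_inv.
split=> // h; have [a [b ->]] := fraction_quotient h.
apply: almost_invariantM => //; [exact: mulgI|exact: inv_f|].
have ratioVE n : #|` stay (f b)^-1%g (fF n)|%:R / #|` fF n|%:R =
    #|` stay (f b) (fF n)|%:R / #|` fF n|%:R :> R by rewrite card_stayV.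
rewrite /almost_invariant (funext ratioVE); exact: inv_f.
Qed.
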